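(* Let $A=\{a_s(n_s)\}_{s=1}^k$ be a finite system of arithmetic sequences ($a_s\in\mathbb{Z}$, $n_s\in\mathbb{Z}^+$), and let $m_1,\ldots,m_k$ be integers relatively prime to $n_1,\ldots,n_k$ respectively. Let $l$ be any nonnegative integer with $w_A(x)\ge l$ for all $x\in\mathbb{Z}$, and set $$W_l=\max_{\substack{I\subseteq\{1,\ldots,k\}\\ |I|=k-l}}\Big|\Big\{\Big\{\sum_{s\in J}\frac{m_s}{n_s}\Big\}:\ J\subseteq I\Big\}\Big|,$$ so that $W_l\le 2^{k-l}$. Then the covering function $w_A$ takes its minimum on every set of $W_l$ consecutive integers; that is, every set of $W_l$ consecutive integers contains some $x$ with $w_A(x)=\min_{y\in\mathbb{Z}}w_A(y)$.
   Context: $\mathbb{Z}^+=\{1,2,3,\ldots\}$. For $a\in\mathbb{Z}$ and $n\in\mathbb{Z}^+$, $a(n)=\{a+nx:\ x\in\mathbb{Z}\}$. The covering function of $A$ is $w_A(x)=|\{1\le s\le k:\ x\in a_s(n_s)\}|$ for $x\in\mathbb{Z}$. For a real number $x$, $\{x\}$ denotes its fractional part; in the definition of $W_l$ the outer braces denote a set and the inner braces the fractional part. An empty sum is $0$. *)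

(* Defs.v *)
From mathcomp Require Import all_boot all_order all_algebra finmap.

Set Implicit Arguments.
Unset Strict Implicit.
Unset Printing Implicit Defensive.

Import Order.TTheory GRing.Theory Num.Theory.
Local Open Scope ring_scope.

(* The arithmetic sequence a(n) = a + nZ, as a decidable predicate on int; *)
(* [arith_seqP] gives the set-builder form.                                *)
Definition arith_seq (a : int) (n : nat) : pred int :=
  [pred x | (n%:Z %| x - a)%Z].

Lemma arith_seqP (a : int) (n : nat) (x : int) :
  reflect (exists y : int, x = a + n%:Z * y) (x \in arith_seq a n).
Proof.
apply: (iffP dvdzP) => [[y xaE]|[y ->]]; exists y; last first.
  by rewrite addrC addKr mulrC.
by rewrite mulrC -xaE addrC subrK.
Qed.

Definition covering (k : nat) (a : 'I_k -> int) (n : 'I_k -> nat) (x : int) :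
  nat := #|[set s : 'I_k | x \in arith_seq (a s) (n s)]|.

Definition frac_part (x : rat) : rat := x - (Num.floor x)%:~R.

Definition subset_sum_fracs (k : nat) (m : 'I_k -> int) (n : 'I_k -> nat)
    (I : {set 'I_k}) : {fset rat} :=
  [fset frac_part (\sum_(s in J) (m s)%:~R / (n s)%:R) 
     | J : {set 'I_k} in powerset I]%fset.

(* The subtraction k - l is never truncated in use: a system of k sequences *)
(* covering some integer at least l times has l <= k.                       *)
Definition Wmax (k : nat) (m : 'I_k -> int) (n : 'I_k -> nat) (l : nat) : nat :=
  (\max_(I : {set 'I_k} | #|I| == k - l) #|` subset_sum_fracs m n I|)%N.

Definition attains_min (f : int -> nat) (x : int) : Prop :=
  forall y : int, (f x <= f y)%N.

(* Main.v *)
Require Import Defs.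
From mathcomp Require Import all_boot all_order all_algebra all_field finmap.

Import Order.TTheory GRing.Theory Num.Theory.
Local Open Scope ring_scope.

(** Let [y] be a point where the covering function is minimal and let [C] be
    the set of sequences through [y]; the sequences of index outside [C] all
    miss [y].  Everything follows from one fact ([gap_in_interval]): if the
    sequences of index in [I] miss some integer, then they miss an integer in
    every interval whose length is the number of fractional parts of the sums
    of [m s / n s] over subsets of [I].  Indeed a point missed by all the
    sequences outside [C] is covered at most [#|C|] times, so the minimum is
    attained there.  As [l <= #|C|], the complement of [C] lies in a set of
    [k - l] indices, so it has at most [Wmax m n l] such fractional parts.

    To prove the fact, write [e t] for the exponential of 2 i pi t.  As [m s]
    is prime to [n s], the product over [s] in [I] of the factors
    [1 - e (m s / n s * (x - a s))] vanishes exactly when some sequence of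
    index in [I] contains [x].  Once expanded ([prod_1sub]), it is a
    combination of the geometric sequences [x |-> e (x * theta)], where [theta]
    runs over the sums of [m s / n s] on subsets of [I], and [e theta] depends
    only on the fractional part of [theta].  A combination of powers of [w]
    numbers which vanishes at [w] consecutive exponents satisfies a linear
    recurrence of order [w], hence vanishes at all later ones ([exp_sum_eq0]);
    by periodicity the product would then vanish everywhere, and no integer
    would be missed. *)

(** The values at exponents below [size U] determine all the others, because
    ['X^i] and its remainder modulo the product of the [('X - v%:P)] agree at
    each base [u j], and this remainder has degree less than [size U]. *)
Lemma exp_sum_eq0 (F : fieldType) (T : finType) (Q : pred T) (C u : T -> F)
    (U : seq F) (uU : forall j, Q j -> u j \in U)
    (sum0 : forall i, (i < size U)%N -> \sum_(j | Q j) C j * u j ^+ i = 0) :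
  forall i, \sum_(j | Q j) C j * u j ^+ i = 0.
Proof.
move=> i; pose P := \prod_(v <- U) ('X - v%:P).
have szP : size P = (size U).+1 by rewrite size_prod_XsubC.
pose R : {poly F} := 'X^i %% P.
have szR : (size R <= size U)%N.
  by rewrite -ltnS -szP ltn_modp -size_poly_eq0 szP.
have uR j : Q j -> u j ^+ i = R.[u j].
  move=> Qj; have /rootP Pu0 : root P (u j) by rewrite root_prod_XsubC uU.
  by rewrite -hornerXn (divp_eq 'X^i P) hornerD hornerM Pu0 mulr0 add0r.
transitivity (\sum_(t < size U) R`_t * \sum_(j | Q j) C j * u j ^+ t).
  under [RHS]eq_bigr do rewrite big_distrr /=.
  rewrite exchange_big /=; apply: eq_bigr => j Qj.
  rewrite uR // (horner_coef_wide _ szR) big_distrr /=.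
  by apply: eq_bigr => t _; rewrite mulrCA.
by apply: big1 => t _; rewrite sum0 ?mulr0.
Qed.

Lemma prim_expz_eq1 {F : fieldType} {N : nat} {z : F} (t : int) :
  N.-primitive_root z -> (z ^ t == 1) = (N%:Z %| t)%Z.
Proof.
move=> zP; rewrite dvdzE /= (prim_order_dvd zP).
by case: t => t //=; rewrite NegzE -exprnN invr_eq1.
Qed.

Lemma prod_1sub (R : comNzRingType) (T : finType) (I : {set T}) (f : T -> R) :
  \prod_(s in I) (1 - f s) =
    \sum_(J : {set T} | J \subset I) \prod_(s in J) - f s.
Proof.
transitivity (\prod_s ((if s \in I then - f s else 0) + 1)).
  rewrite [LHS]big_mkcond; apply: eq_bigr => s _.
  by case: (s \in I); rewrite ?add0r // addrC.
rewrite bigA_distr [RHS]big_mkcond; apply: eq_bigr => J _.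
case: ifPn => [/subsetP JI|/subsetPn[s sJ sI]].
  rewrite [RHS]big_mkcond; apply: eq_bigr => s _.
  by case: ifP => // /JI ->.
by rewrite (bigD1 s) //= sJ (negPf sI) mul0r.
Qed.

Lemma arith_seq_congr {a : int} {n : nat} {x y : int} :
  (n%:Z %| y - x)%Z -> (x \in arith_seq a n) = (y \in arith_seq a n).
Proof.
move=> n_yx; rewrite !inE /= -[in RHS](subrK x y) -addrA.
by rewrite -[LHS]/(_ \in dvdz _) -[RHS]/(_ \in dvdz _) [RHS]rpredDl.
Qed.

(** The values [e (t / N)], for [N] a common multiple of the moduli, are the
    powers [z ^ t] of a primitive [N]-th root of unity [z], which makes the
    argument purely algebraic. *)
Lemma gap_in_interval (k : nat) (a : 'I_k -> int) (n : 'I_k -> nat)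
    (m : 'I_k -> int) (n_gt0 : forall s, (0 < n s)%N)
    (co_mn : forall s, coprimez (m s) (n s)%:Z) (I : {set 'I_k}) (y c : int) :
    (forall s, s \in I -> y \notin arith_seq (a s) (n s)) ->
  exists2 x : int, c <= x < c + #|` subset_sum_fracs m n I|%:Z
    & forall s, s \in I -> x \notin arith_seq (a s) (n s).
Proof.
set S := subset_sum_fracs m n I => yI.
pose N := (\prod_s n s)%N.
have N_gt0 : (0 < N)%N by apply: prodn_gt0.
pose d s := (N %/ n s)%N.
have dE s : N = (d s * n s)%N.
  by rewrite divnK // /N (bigD1 s) //= dvdn_mulr.
have d_gt0 s : (0 < d s)%N by move: N_gt0; rewrite (dE s) muln_gt0 => /andP[].
have [z zP] := C_prim_root_exists N_gt0.
have z_neq0 : z != 0.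
  apply/eqP => z0; have := prim_expr_order zP.
  by move/eqP; rewrite z0 expr0n gtn_eqF // eq_sym oner_eq0.
have zD := fun p q => expfzDr p q z_neq0.
(* This is [e (m s / n s * (x - a s))], as [d s / N] is the inverse of [n s]. *)
pose f s (x : int) := z ^ (m s * (d s)%:Z * (x - a s)).
have f_eq1 s x : (f s x == 1) = (x \in arith_seq (a s) (n s)).
  rewrite (prim_expz_eq1 _ zP) (dE s) PoszM mulrAC (mulrC (m s * _)).
  rewrite dvdz_mul2l ?Gauss_dvdzr //; last by rewrite lt0r_neq0 // ltz_nat.
  by rewrite coprimez_sym.
pose g (x : int) := \prod_(s in I) (1 - f s x).
have g_neq0 x : (g x != 0) = [forall s in I, x \notin arith_seq (a s) (n s)].
  by apply/prodf_neq0/forall_inP => gx s /gx; rewrite subr_eq0 eq_sym f_eq1.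
pose u (J : {set 'I_k}) := z ^ (\sum_(s in J) m s * (d s)%:Z).
pose E (r : rat) := z ^ Num.floor (N%:R * r).
(* The base attached to [J] is a function of the fractional part alone:
   removing an integer from the sum divides [u J] by a power of [z ^ N],
   which is 1. *)
have uE (J : {set 'I_k}) :
    u J = E (frac_part (\sum_(s in J) (m s)%:~R / (n s)%:R)).
  rewrite /E /frac_part mulrBr.
  have -> : N%:R * (\sum_(s in J) (m s)%:~R / (n s)%:R)
            = (\sum_(s in J) m s * (d s)%:Z)%:~R :> rat.
    rewrite big_distrr /= rmorph_sum /=; apply: eq_bigr => s _.
    rewrite (dE s) natrM rmorphM /= mulrCA mulfK //.
    by rewrite pnatr_eq0 -lt0n.
  set t := Num.floor (bigop _ _ _).
  rewrite -[_ * t%:~R](rmorphM intr N%:Z t) -rmorphB /= intrKfloor zD.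
  rewrite (_ : z ^ (- (N%:Z * t)) = 1) ?mulr1 //.
  by apply/eqP; rewrite (prim_expz_eq1 _ zP) rpredN dvdz_mulr.
pose C (J : {set 'I_k}) := \prod_(s in J) - f s c.
have gE (i : nat) : g (c + i%:Z) =
    \sum_(J : {set 'I_k} | J \subset I) C J * u J ^+ i.
  rewrite /g prod_1sub; apply: eq_bigr => J _.
  rewrite /u (big_morph (fun t => z ^ t) zD (expr0z z)) -prodrXl -big_split /=.
  apply: eq_bigr => s _; rewrite mulNr; congr (- _).
  by rewrite exprnP exprz_exp -zD -mulrDr addrAC.
pose W := #|` S|.
have [/existsP[i gi]|/existsPn noi] :=
  boolP [exists i : 'I_W, g (c + i%:Z) != 0].
  exists (c + i%:Z); first by rewrite lerDl ltrD2l ltz_nat ltn_ord.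
  by move: gi; rewrite g_neq0 => /forall_inP.
pose U := [seq E r | r <- S].
have sizeU : size U = W by rewrite size_map.
have g0 (i : nat) : g (c + i%:Z) = 0.
  rewrite gE; apply: (@exp_sum_eq0 _ _ _ _ _ U) => [J JI|{}i].
    rewrite uE; apply: map_f; apply: in_imfset.
    by rewrite /= powersetE.
  by rewrite sizeU => ltiW; rewrite -gE; apply/eqP/negPn/(noi (Ordinal ltiW)).
(* [exp_sum_eq0] only reaches points above [c], so [y] is replaced by the
   point of [c, c + N) congruent to it modulo [N]. *)
pose i := `|((y - c) %% N)%Z|%N.
have iE : i%:Z = ((y - c) %% N)%Z by rewrite gez0_abs // modz_ge0 // -lt0n.
suff : g (c + i%:Z) != 0 by rewrite g0 eqxx.
rewrite g_neq0; apply/forall_inP => s sI.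
rewrite (@arith_seq_congr _ _ _ y) ?yI // opprD addrA iE.
rewrite {1}(divz_eq (y - c) N) addrK.
by rewrite dvdz_mull // (dE s) PoszM dvdz_mull.
Qed.

(** The covering function is periodic modulo the product [N] of the moduli, so
    a minimum over one period is a global minimum. *)
Lemma ex_attains_min_covering (k : nat) (a : 'I_k -> int) (n : 'I_k -> nat) :
  (forall s, (0 < n s)%N) -> exists y, attains_min (covering a n) y.
Proof.
move=> n_gt0; pose N := (\prod_s n s)%N.
have N_gt0 : (0 < N)%N by apply: prodn_gt0.
have [r _ rmin] := arg_minnP (fun r : 'I_N => covering a n (r : nat)%:Z)
  (erefl : xpredT (Ordinal N_gt0)).
exists (r : nat)%:Z => x.
have x_ge0 : 0 <= (x %% N)%Z by rewrite modz_ge0 // -lt0n.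
have x_lt : (`|(x %% N)%Z| < N)%N.
  by rewrite -ltz_nat gez0_abs // ltz_mod // -lt0n.
have := rmin (Ordinal x_lt) isT; rewrite /= gez0_abs // => /leq_trans; apply.
apply/subset_leq_card/subsetP => s; rewrite !in_set.
rewrite (@arith_seq_congr _ _ _ x) // {1}(divz_eq x N) addrK.
by rewrite dvdz_mull // /N (bigD1 s) //= PoszM dvdz_mulr.
Qed.

Lemma card_subset_sum_fracs (k : nat) (m : 'I_k -> int) (n : 'I_k -> nat)
    (I : {set 'I_k}) :
  (#|` subset_sum_fracs m n I| <= 2 ^ #|I|)%N.
Proof.
apply: leq_trans (leq_imfset_card _ _ _) _.
by rewrite -card_powerset cardE.
Qed.

Lemma subset_sum_fracsS (k : nat) (m : 'I_k -> int) (n : 'I_k -> nat)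
    (I I' : {set 'I_k}) :
  I \subset I' -> (subset_sum_fracs m n I `<=` subset_sum_fracs m n I')%fset.
Proof.
move=> sII'; apply/fsubsetP => r /imfsetP[J /= JI ->].
apply: in_imfset => /=; move: JI; rewrite !powersetE => /subset_trans.
exact.
Qed.

Theorem corollary1p3 (k : nat) (a : 'I_k -> int) (n : 'I_k -> nat)
    (m : 'I_k -> int) (l : nat)
    (n_gt0 : forall s : 'I_k, (0 < n s)%N)
    (co_mn : forall s : 'I_k, coprimez (m s) (n s)%:Z)
    (cover_ge : forall x : int, (l <= covering a n x)%N) :
  (Wmax m n l <= 2 ^ (k - l))%N /\
  (forall c : int, exists x : int,
     c <= x < c + (Wmax m n l)%:Z /\ attains_min (covering a n) x).
Proof.
split=> [|c].
  by apply/bigmax_leqP => I /eqP <-; apply: card_subset_sum_fracs.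
have [y ymin] := ex_attains_min_covering _ a _ n_gt0.
pose C := [set s | y \in arith_seq (a s) (n s)].
have [t [uniq_t size_t tC]] := card_geqP (cover_ge y).
(* [t] lists exactly [l] of the sequences through [y], so that its complement
   [I] contains the complement of [C] and is one of the index sets over which
   [Wmax] is a maximum. *)
pose I := ~: [set s in t].
have cardI : #|I| = (k - l)%N.
  by rewrite cardsCs setCK card_ord cardsE (card_uniqP uniq_t) size_t.
have [|x xc xI] := @gap_in_interval k a n m n_gt0 co_mn (~: C) y c.
  by move=> s; rewrite !inE.
exists x; split.
  case/andP: xc => -> /= /lt_le_trans; apply.
  rewrite lerD2l lez_nat.
  apply: leq_trans (leq_bigmax_cond _ (introT eqP cardI)).
  apply/fsubset_leq_card/subset_sum_fracsS.
  by rewrite setCS; apply/subsetP => s; rewrite inE => /tC.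
move=> v; apply: leq_trans (ymin v).
apply/subset_leq_card/subsetP => s; rewrite inE => xs.
by apply: contraLR xs => sC; apply: xI; rewrite in_setC.
Qed.
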